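(* Let $(X,d,m)$ be a geodesic, non-branching, separable metric measure space, let $\mu_0,\mu_1$ be Borel probability measures on $X$ joined by a geodesic in the $L^2$-Wasserstein space, let $\varphi$ be a $d^2$-concave Kantorovich potential for $(\mu_0,\mu_1)$, and let $a\in\varphi(\mathrm{supp}\,\mu_0)$ be a real number. Then the set $$\Gamma_a=\Big\{(x,y)\in X\times X:\ \varphi(x)+\varphi^c(y)=\tfrac12d^2(x,y),\ \varphi(x)=a\Big\}$$ is $d$-cyclically monotone.
   Context: No curvature assumption is made. Non-branching: for all $r\ge0$, $x,y\in X$ with $d(x,y)=r/2$, the set $\{z:d(x,z)=r\}\cap\{z:d(y,z)=r/2\}$ has at most one point. $d^2$-transform: $\varphi^c(y)=\inf_{x\in X}\frac12d^2(x,y)-\varphi(x)$; $\varphi$ is $d^2$-concave if $\varphi=v^c$ for some $v:X\to\mathbb R\cup\{-\infty\}$; it is a Kantorovich potential for $(\mu_0,\mu_1)$ if $(\varphi,\varphi^c)$ is a maximizing pair in the dual Kantorovich problem with cost $d^2/2$. A set $\Lambda\subset X\times X$ is $d$-cyclically monotone if for all $n$ and $(x_1,y_1),\dots,(x_n,y_n)\in\Lambda$, $\sum_{i=1}^nd(x_i,y_i)\le\sum_{i=1}^nd(x_i,y_{i+1})$ with $y_{n+1}=y_1$. *)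

(* Defs.v *)
From HB Require Import structures.
From mathcomp Require Import all_boot all_order all_algebra.
From mathcomp Require Import all_classical all_reals all_analysis.

Set Implicit Arguments.
Unset Strict Implicit.
Unset Printing Implicit Defensive.

Import Order.TTheory GRing.Theory Num.Theory.
Import numFieldNormedType.Exports.

Local Open Scope classical_set_scope.
Local Open Scope ring_scope.
Local Open Scope ereal_scope.

(* The library's measurable types are pointed.  The base point is never used;
   it costs no generality for a space carrying a probability measure. *)
#[short(type="pmetricType")]
HB.structure Definition PMetric (K : numDomainType) :=
  {T of Pointed T & Metric K T}.

Notation borel X := (g_sigma_algebraType (@open X)).

Section metric_notions.
Context {R : realType} {X : pmetricType R}.

Definition separable_space := exists2 D : set X, countable D & dense D.

Definition geodesic_space :=
  forall x y : X, exists g : R -> X, [/\ g 0%R = x, g 1%R = y &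
    forall s t : R, (0 <= s <= 1)%R -> (0 <= t <= 1)%R ->
      mdist (g s) (g t) = (`|s - t| * mdist x y)%R].

Definition non_branching :=
  forall (r : R) (x y : X), (0 <= r)%R -> mdist x y = (r / 2)%R ->
    is_subset1 ([set z | mdist x z = r] `&` [set z | mdist y z = (r / 2)%R]).

(* [ordS i] is the cyclic successor of [i], so the last index is sent to the
   first one. *)
Definition d_cyclically_monotone (L : set (X * X)) :=
  forall (n : nat) (x y : 'I_n -> X), (forall i, L (x i, y i)) ->
    (\sum_(i < n) mdist (x i) (y i) <=
     \sum_(i < n) mdist (x i) (y (ordS i)))%R.

Definition cost (x y : X) : R := (2^-1 * mdist x y ^+ 2)%R.

(* Functions X -> R U {-oo} are [X -> \bar R] bounded by [< +oo], so that no
   indeterminate difference occurs below. *)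
Definition ctransform (phi : X -> \bar R) (y : X) : \bar R :=
  ereal_inf [set (cost x y)%:E - phi x | x in [set: X]].

Definition d2_concave (phi : X -> \bar R) :=
  exists2 v : X -> \bar R, (forall x, v x < +oo) & phi = ctransform v.

Definition Gamma (phi : X -> \bar R) (a : R) : set (X * X) :=
  [set z | phi z.1 + ctransform phi z.2 = (cost z.1 z.2)%:E
           /\ phi z.1 = a%:E].

End metric_notions.
Arguments separable_space {R} X.
Arguments geodesic_space {R} X.
Arguments non_branching {R} X.

Section optimal_transport.
Context {R : realType} {X : pmetricType R}.
Implicit Types mu nu : probability (borel X) R.

Definition supp mu : set X :=
  [set x : X | forall U : set X, open U -> U x -> 0 < mu U].

Definition coupling mu nu (pi : probability (borel X * borel X)%type R) :=
  forall A : set (borel X), measurable A ->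
    pi (A `*` setT) = mu A /\ pi (setT `*` A) = nu A.

Definition finite_second_moment mu :=
  exists x0 : X, \int[mu]_x ((mdist x0 (x : X)) ^+ 2)%:E < +oo.

Definition W2 mu nu : \bar R :=
  sqrte (ereal_inf [set \int[pi]_z ((mdist (z.1 : X) (z.2 : X)) ^+ 2)%:E
                   | pi in coupling mu nu]).

Definition joined_by_W2_geodesic mu nu :=
  exists g : R -> probability (borel X) R,
    [/\ forall A, measurable A -> g 0%R A = mu A,
        forall A, measurable A -> g 1%R A = nu A,
        forall t : R, (0 <= t <= 1)%R -> finite_second_moment (g t) &
        forall s t : R, (0 <= s <= 1)%R -> (0 <= t <= 1)%R ->
          W2 (g s) (g t) = `|s - t|%:E * W2 mu nu].

Definition dual_admissible mu nu (f g : X -> \bar R) :=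
  [/\ forall x, f x < +oo, forall y, g y < +oo,
      mu.-integrable setT f, nu.-integrable setT g &
      forall x y, f x + g y <= (cost x y)%:E].

Definition dual_value mu nu (f g : X -> \bar R) : \bar R :=
  \int[mu]_x f x + \int[nu]_y g y.

Definition dual_maximizer mu nu (f g : X -> \bar R) :=
  dual_admissible mu nu f g /\
  forall f' g' : X -> \bar R, dual_admissible mu nu f' g' ->
    dual_value mu nu f' g' <= dual_value mu nu f g.

Definition kantorovich_potential mu nu (phi : X -> \bar R) :=
  dual_maximizer mu nu phi (ctransform phi).

End optimal_transport.

(* Main.v *)
(* If [phi x = phi x' = a] and [(x, y)] is a contact pair, then
   [a + phi^c y] equals the cost of [(x, y)] and is at most the cost of
   [(x', y)], so [d(x, y) <= d(x', y)].  Cyclical monotonicity thus holds term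
   by term, after a cyclic shift of the summation index. *)
Require Import Defs.
From HB Require Import structures.
From mathcomp Require Import all_boot all_order all_algebra.
From mathcomp Require Import all_classical all_reals all_analysis.

Import Order.TTheory GRing.Theory Num.Theory.

Local Open Scope classical_set_scope.
Local Open Scope ring_scope.

Lemma ctransform_le {R : realType} {X : pmetricType R} (phi : X -> \bar R)
    (x y : X) :
  (ctransform phi y <= (cost x y)%:E - phi x)%E.
Proof. by apply: ereal_inf_lbound; exists x. Qed.

Lemma Gamma_mdist_le {R : realType} {X : pmetricType R} {phi : X -> \bar R}
    {a : R} {x x' y : X} :
  Gamma phi a (x, y) -> phi x' = a%:E -> mdist x y <= mdist x' y.
Proof.
move=> [/= + phix] phix'; rewrite phix.
have := ctransform_le phi x' y; rewrite phix'.
(* The contact equation has a finite right-hand side and [a] is real, so an infinite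
   [ctransform phi y] is contradictory. *)
case: (ctransform phi y) => [b||] //=.
rewrite -EFinB lee_fin => b_le [cost_eq].
have : cost x y <= cost x' y by rewrite -cost_eq addrC -lerBrDr.
by rewrite /cost ler_pM2l ?invr_gt0// ler_sqr// nnegrE mdist_ge0.
Qed.

Theorem proposition4p1 (R : realType) (X : pmetricType R)
    (m : {measure set (borel X) -> \bar R})
    (X_geodesic : geodesic_space X)
    (X_non_branching : non_branching X)
    (X_separable : separable_space X)
    (mu0 mu1 : probability (borel X) R)
    (mu_geodesic : joined_by_W2_geodesic mu0 mu1)
    (phi : X -> \bar R)
    (phi_concave : d2_concave phi)
    (phi_potential : kantorovich_potential mu0 mu1 phi)
    (a : R) (a_in : (phi @` supp mu0) a%:E) :
  d_cyclically_monotone (Gamma phi a).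
Proof.
(* Only the left sum is shifted: both [i]-th terms then end at [y (ordS i)], and their first points
   [x (ordS i)] and [x i] lie on the same level set of [phi]. *)
move=> n x y Gxy; rewrite (reindex_inj (@ordS_inj n)).
apply: ler_sum => i _.
exact: Gamma_mdist_le (Gxy (ordS i)) (Gxy i).2.
Qed.
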